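(* Let a reductive complex Lie group $G$ act linearly on a finite dimensional complex vector space $V$. Let $U\subset V$ be an open subset, $S\subset U$ a closed analytic subset with $0\in S$, and assume that $G$ has a restricted action on the pair $(S,U)$. Then $\widetilde S:=\bigcup_{g\in G}g\cdot S$ is a closed $G$-invariant analytic subset of the $G$-invariant open set $\widetilde U:=\bigcup_{g\in G}g\cdot U\subset V$, and $\widetilde S\cap U=S$.
   Context: A restricted action of $G$ on the pair $(S,U)$ is defined by the property that for all $s\in S$ and $g\in G$ with $g\cdot s\in U$ the point $g\cdot s$ is contained in $S$. *)

(* Defs.v *)
From HB Require Import structures.
From mathcomp Require Import all_boot all_order all_algebra.
From mathcomp Require Import complex.
From mathcomp Require Import all_classical all_reals all_analysis.

Set Implicit Arguments.
Unset Strict Implicit.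
Unset Printing Implicit Defensive.

Import Order.TTheory GRing.Theory Num.Theory.
Import numFieldNormedType.Exports.

Local Open Scope classical_set_scope.
Local Open Scope ring_scope.

(* The field of complex numbers is [R[i]] for [R : realType].  Since [differentiable] is Frechet differentiability over the
   scalar field of the normed modules at hand, over [R[i]] it means complex
   differentiability; at all points of an open set this is holomorphy. *)

(* All norms on a finite-dimensional complex vector space are equivalent, so the
   norm carried by the structure only serves to express its topology and
   differentiability. *)
#[short(type="normedVectType")]
HB.structure Definition NormedVector (K : numFieldType) :=
  {V of NormedModule K V & Vector K V}.

(* [coord] and [param] are total functions, meaningful only on [dom] and on
   [coord @` dom] respectively. *)
Record chart (K : numFieldType) (E : normedModType K) (M : topologicalType) :=
  Chart { dom : set M; coord : M -> E; param : E -> M }.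

Definition is_chart (K : numFieldType) (E : normedModType K)
    (M : topologicalType) (c : chart E M) : Prop :=
  [/\ open (dom c), open (coord c @` dom c),
      forall x, dom c x -> param c (coord c x) = x,
      {within dom c, continuous (coord c)} &
      {within coord c @` dom c, continuous (param c)}].

(* The condition at [x] bears on [coord d \o param c] in a neighbourhood of
   [coord c x] only, where the transition map is defined. *)
Definition compatible (K : numFieldType) (E : normedModType K)
    (M : topologicalType) (c d : chart E M) : Prop :=
  forall x, dom c x -> dom d x ->
    differentiable (coord d \o param c) (coord c x).

Definition holomorphic_atlas (K : numFieldType) (E : normedModType K)
    (M : topologicalType) (A : set (chart E M)) : Prop :=
  [/\ forall c, A c -> is_chart c,
      forall x, exists2 c, A c & dom c x &
      forall c d, A c -> A d -> compatible c d].

Definition prod_chart (K : numFieldType) (E F : normedModType K)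
    (M N : topologicalType) (c : chart E M) (d : chart F N) :
    chart (E * F)%type (M * N)%type :=
  Chart (dom c `*` dom d) (fun p => (coord c p.1, coord d p.2))
    (fun q => (param c q.1, param d q.2)).

Definition prod_atlas (K : numFieldType) (E F : normedModType K)
    (M N : topologicalType) (A : set (chart E M)) (B : set (chart F N)) :
    set (chart (E * F)%type (M * N)%type) :=
  [set e | exists c d, [/\ A c, B d & e = prod_chart c d]].

Definition linear_atlas (K : numFieldType) (E : normedModType K) :
    set (chart E E) :=
  [set Chart setT id id].

Definition holomorphic (K : numFieldType) (E F : normedModType K)
    (M N : topologicalType) (A : set (chart E M)) (B : set (chart F N))
    (f : M -> N) : Prop :=
  continuous f /\
  forall c d x, A c -> B d -> dom c x -> dom d (f x) ->
    differentiable (coord d \o f \o param c) (coord c x).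

HB.mixin Record isComplexLieGroup (R : realType) G
    of Topological G & Group G := {
  lie_dim : nat;
  lie_atlas : set (chart 'rV[R[i]]_lie_dim G);
  lie_hausdorff : hausdorff_space G;
  lie_second_countable : @second_countable G;
  lie_atlasP : holomorphic_atlas lie_atlas;
  lie_mul_holomorphic :
    holomorphic (prod_atlas lie_atlas lie_atlas) lie_atlas
      (fun p : G * G => (p.1 * p.2)%g);
  lie_inv_holomorphic :
    holomorphic lie_atlas lie_atlas (fun x : G => (x^-1)%g)
}.

#[short(type="complexLieGroupType")]
HB.structure Definition ComplexLieGroup (R : realType) :=
  {G of Topological G & Group G & isComplexLieGroup R G}.

Definition subgroup (G : groupType) (K : set G) : Prop :=
  [/\ K 1%g, forall x y, K x -> K y -> K (x * y)%g &
      forall x, K x -> K (x^-1)%g].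

(* A complex Lie group is reductive when it is the universal complexification of
   a compact subgroup K.  K is then a real Lie group and its continuous
   homomorphisms to Lie groups are automatically smooth.  [phi] is total, but
   only its values on K matter. *)
Definition reductive (R : realType) (G : complexLieGroupType R) : Prop :=
  exists K : set G, [/\ subgroup K, compact K &
    forall (H : complexLieGroupType R) (phi : G -> H),
      {within K, continuous phi} ->
      (forall x y, K x -> K y -> phi (x * y)%g = (phi x * phi y)%g) ->
      exists! Phi : G -> H,
        [/\ holomorphic (@lie_atlas R G) (@lie_atlas R H) Phi,
            forall x y, Phi (x * y)%g = (Phi x * Phi y)%g &
            forall x, K x -> Phi x = phi x]].

Definition linear_action (R : realType) (G : complexLieGroupType R)
    (V : normedVectType R[i]) (act : G -> V -> V) : Prop :=
  [/\ forall v, act 1%g v = v,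
      forall g h v, act (g * h)%g v = act g (act h v),
      forall g, linear (act g) &
      holomorphic (prod_atlas (@lie_atlas R G) (@linear_atlas _ V))
        (@linear_atlas _ V) (fun p : G * V => act p.1 p.2)].

Definition closed_in (T : topologicalType) (Omega A : set T) : Prop :=
  exists2 F, closed F & A = F `&` Omega.

Definition analytic_in (R : realType) (V : normedVectType R[i])
    (Omega A : set V) : Prop :=
  A `<=` Omega /\
  forall p, Omega p ->
    exists (W : set V) (m : nat) (f : 'I_m -> V -> R[i]^o),
      [/\ open W, W p, W `<=` Omega,
          forall i x, W x -> differentiable (f i) x &
          A `&` W = [set x | W x /\ forall i, f i x = 0]].

Definition restricted_action (G V : Type) (act : G -> V -> V) (S U : set V) :
    Prop :=
  forall s g, S s -> U (act g s) -> S (act g s).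

Definition action_invariant (G V : Type) (act : G -> V -> V) (A : set V) : Prop :=
  forall g x, A x -> A (act g x).

Definition saturation (G V : Type) (act : G -> V -> V) (A : set V) : set V :=
  \bigcup_(g in [set: G]) (act g @` A).

(* Main.v *)
(* The restricted action condition says precisely that the saturation of S meets
   U in S only, hence meets each translate g U in g S.  As the translates g U
   form an open cover of the saturation of U and g acts by a linear
   homeomorphism, closedness and local analytic equations are carried over from
   (S, U) to (g S, g U). *)
Require Import Defs.
From HB Require Import structures.
From mathcomp Require Import all_boot all_order all_algebra.
From mathcomp Require Import complex.
From mathcomp Require Import all_classical all_reals all_analysis.
Import Order.TTheory GRing.Theory Num.Theory.
Import numFieldNormedType.Exports.
Local Open Scope classical_set_scope.
Local Open Scope ring_scope.

(** A continuous linear map is its own differential. Linearity is given here as a property of a bare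
    function, so the function is first packed as a bundled linear map. *)
Lemma linear_continuous_differentiable (K : numFieldType)
    (E F : normedModType K) (f : E -> F) (x : E) :
  linear f -> continuous f -> differentiable f x.
Proof.
move=> f_lin f_cont.
pose fL := GRing.isLinear.Build K E F *:%R f f_lin.
pose f' : {linear E -> F} := HB.pack f fL.
exact: (@linear_differentiable _ _ _ f').
Qed.

Section LinearAction.
Context (R : realType) (G : complexLieGroupType R) (V : normedVectType R[i]).
Variable act : G -> V -> V.
Hypothesis act_linear : linear_action act.

Lemma linear_action1 v : act 1%g v = v.
Proof. by case: act_linear. Qed.

Lemma linear_actionM g h v : act (g * h)%g v = act g (act h v).
Proof. by case: act_linear. Qed.

Lemma linear_actionK g : cancel (act g) (act g^-1%g).
Proof. by move=> v; rewrite -linear_actionM mulVg linear_action1. Qed.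

Lemma linear_actionVK g : cancel (act g^-1%g) (act g).
Proof. by move=> v; rewrite -linear_actionM mulgV linear_action1. Qed.

(** Joint continuity of the action, restricted to the slice of [G * V] over [g]. *)
Lemma linear_action_continuous g : continuous (act g).
Proof.
case: act_linear => _ _ _ [act_cont _] v.
apply: (@continuous_comp _ _ _ (pair g) (fun p => act p.1 p.2)).
  by apply: cvg_pair; [exact: cvg_cst | exact: cvg_id].
exact: act_cont.
Qed.

Lemma linear_action_differentiable g v : differentiable (act g) v.
Proof.
apply: linear_continuous_differentiable; last exact: linear_action_continuous.
by case: act_linear.
Qed.

(** Seen as a preimage, a translate of an open set is open by continuity alone. *)
Lemma linear_action_image g (A : set V) : act g @` A = act g^-1%g @^-1` A.
Proof.
apply/seteqP; split=> [_ [v Av <-]|v Av] /=; first by rewrite linear_actionK.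
by exists (act g^-1%g v); rewrite ?linear_actionVK.
Qed.

Lemma open_linear_action_image g (A : set V) : open A -> open (act g @` A).
Proof.
rewrite linear_action_image; apply: open_comp => v _.
exact: linear_action_continuous.
Qed.

Lemma saturation_invariant (A : set V) :
  action_invariant act (saturation act A).
Proof.
move=> g _ [h _ [v Av <-]]; exists (g * h)%g => //.
by exists v => //; rewrite linear_actionM.
Qed.

Lemma subset_saturation (A : set V) : A `<=` saturation act A.
Proof. by move=> v Av; exists 1%g => //; exists v; rewrite ?linear_action1. Qed.

Lemma open_saturation (A : set V) : open A -> open (saturation act A).
Proof. by move=> oA; apply: bigcup_open => g _; apply: open_linear_action_image. Qed.

Lemma saturation_act (A : set V) g v :
  saturation act A (act g v) <-> saturation act A v.
Proof.
split=> [/(saturation_invariant A g^-1%g)|]; first by rewrite linear_actionK.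
exact: saturation_invariant.
Qed.

Lemma restricted_saturationI (S U : set V) :
  S `<=` U -> restricted_action act S U -> saturation act S `&` U = S.
Proof.
move=> SU resS; apply/seteqP; split=> [_ [[g _ [s Ss <-]]]|s Ss].
  exact: resS.
by split; [exact: subset_saturation | exact: SU].
Qed.

(** The saturations of [S] and [U \ S] cover that of [U], and the restricted action makes them
    disjoint. So the first is the trace of the complement of the second, which is open. *)
Lemma closed_in_saturation (S U : set V) :
  open U -> closed_in U S -> restricted_action act S U ->
  closed_in (saturation act U) (saturation act S).
Proof.
move=> oU [F cF SE] resS.
have SU : S `<=` U by rewrite SE; apply: subIsetr.
exists (~` saturation act (U `\` S)).
  apply/open_closedC/open_saturation.
  (* [S] is closed only relative to [U]; openness of [U \ S] in [V] also uses that [U] is open. *)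
  suff -> : U `\` S = U `&` ~` F by apply: openI => //; exact: closed_openC.
  by rewrite setDE SE setCI setIUr setICr setU0.
apply/seteqP; split=> [x Sx|x [nx [g _ [u Uu xE]]]].
  split; last by case: Sx => g _ [s Ss <-]; exists g => //; exists s; auto.
  (* Disjointness: if [x = g u] lies in the saturation of [S], so does [u] by invariance, and [u] in
     [U] then forces [u] in [S]. *)
  case=> g _ [u [Uu nSu] xE]; apply: nSu.
  rewrite -(restricted_saturationI S U SU resS); split=> //.
  by move: Sx; rewrite -xE saturation_act.
exists g => //; exists u => //; apply: contrapT => nSu.
by apply: nx; exists g => //; exists u.
Qed.

Lemma analytic_in_saturation (S U : set V) :
  analytic_in U S -> restricted_action act S U ->
  analytic_in (saturation act U) (saturation act S).
Proof.
move=> [SU anS] resS; split=> [_ [g _ [s Ss <-]]|_ [g _ [u Uu <-]]].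
  by exists g => //; exists s; auto.
have [W [m [f [oW Wu WU df SWE]]]] := anS u Uu.
(* The equations of [S] near [u] are carried to [g u] by precomposing with the inverse of [g]. *)
exists (act g @` W), m, (fun i => f i \o act g^-1%g); split.
- exact: open_linear_action_image.
- by exists u.
- by move=> _ [w Ww <-]; exists g => //; exists w; auto.
- move=> i _ [w Ww <-]; apply: differentiable_comp.
    exact: linear_action_differentiable.
  by rewrite linear_actionK; apply: df.
(* Since [W] lies in [U], where [S] and its saturation agree, the [f i] already cut out the
   saturation in [W]. Its invariance then transfers this description to the translate of [W]. *)
- have SW w : W w -> saturation act S w <-> forall i, f i w = 0.
    move=> Ww; have SwE : S w <-> saturation act S w.
      rewrite -[X in X w <-> _](restricted_saturationI S U SU resS).
      by split=> [[]|Sw] //; split=> //; apply: WU.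
    have /seteqP[SW1 SW2] := SWE; rewrite -SwE; split=> [Sw|fw].
      by have [] := SW1 w (conj Sw Ww).
    by have [] := SW2 w (conj Ww fw).
  apply/seteqP; split=> [_ [/[swap] -[w Ww <-]]|_ [[w Ww <-] fw]].
    rewrite saturation_act => /(SW w Ww) fw; split; first by exists w.
    by move=> i /=; rewrite linear_actionK.
  split; last by exists w.
  rewrite saturation_act; apply/(SW w Ww) => i.
  by have /= := fw i; rewrite linear_actionK.
Qed.

End LinearAction.

Theorem theorem1 (R : realType) (G : complexLieGroupType R)
    (V : normedVectType R[i]) (act : G -> V -> V) (U S : set V)
    (G_reductive : reductive G)
    (act_linear : linear_action act)
    (U_open : open U)
    (S_closed : closed_in U S)
    (S_analytic : analytic_in U S)
    (S0 : S 0)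
    (act_restricted : restricted_action act S U) :
  [/\ open (saturation act U),
      action_invariant act (saturation act U),
      closed_in (saturation act U) (saturation act S),
      analytic_in (saturation act U) (saturation act S) &
      action_invariant act (saturation act S) /\ saturation act S `&` U = S].
Proof.
split.
- exact: open_saturation.
- exact: saturation_invariant.
- exact: closed_in_saturation.
- exact: analytic_in_saturation.
- split; first exact: saturation_invariant.
  by apply: restricted_saturationI => //; case: S_analytic.
Qed.
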